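(* Let $a\in\mathbb R$ and let $\rho:[0,\infty)\to\mathbb R$ be a solution of the delay equation $\dot\rho(\tau)=a\rho(\tau)-\rho(\tau-1)$ for $\tau\ge1$. (1) If $a>1$ and $\rho(1)\ge\rho(\tau)>0$ for every $\tau\in[0,1]$, then $\rho(\tau)$ diverges exponentially as $\tau\to\infty$. (2) If $a=1$ and $\rho(1)>\rho(\tau)>0$ for every $\tau\in[0,1)$, then $\rho(\tau)$ diverges linearly as $\tau\to\infty$. (3) If $a<1$, then $\rho$ oscillates.
   Context: Solutions have bounded measurable initial data on $[0,1]$ (with a prescribed value at $\tau=1$) and are absolutely continuous on $[1,\infty)$. ''Diverges exponentially'' means $\rho(\tau)\ge Ce^{\lambda\tau}$ for some $C,\lambda>0$ and all large $\tau$; ''diverges linearly'' means that $\rho(\tau)/\tau$ tends to a finite positive limit; ''oscillates'' means that $\rho$ has arbitrarily large zeros. *)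

(* Defs.v *)
From HB Require Import structures.
From mathcomp Require Import all_boot all_order all_algebra.
From mathcomp Require Import all_classical all_reals all_analysis.
From mathcomp Require Import measurable_realfun.
Set Implicit Arguments.
Unset Strict Implicit.
Unset Printing Implicit Defensive.
Import Order.TTheory GRing.Theory Num.Theory.
Import numFieldNormedType.Exports.
Local Open Scope classical_set_scope.
Local Open Scope ring_scope.

Definition abs_continuous (R : realType) (a b : R) (f : R -> R) : Prop :=
  forall e : R, 0 < e -> exists2 d : R, 0 < d &
    forall (n : nat) (u v : 'I_n -> R),
      (forall i, a <= u i /\ u i <= v i /\ v i <= b) ->
      trivIset [set: 'I_n] (fun i => `]u i, v i[%classic) ->
      \sum_(i < n) (v i - u i) < d ->
      \sum_(i < n) `|f (v i) - f (u i)| < e.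

(* On an unbounded interval absolute continuity is understood locally, i.e. on
   every compact subinterval: exponentially growing solutions are not uniformly
   absolutely continuous on the whole half-line. *)
Definition abs_continuous_from (R : realType) (a : R) (f : R -> R) : Prop :=
  forall b : R, abs_continuous a b f.

(* Measurability on R in the library is Borel measurability; here the source is
   R with the sigma-algebra of Lebesgue measurable sets. *)
Definition lebesgue_measurable_fun (R : realType) (D : set R) (f : R -> R)
    : Prop :=
  measurable_fun
    (D : set (g_sigma_algebraType (completed_algebra_gen (@lebesgue_measure R))))
    f.

(* Functions on [0, +oo[ are represented by total functions whose values at
   negative arguments are irrelevant. The data on [0, 1] are only measurable,
   so the equation is required at almost every t >= 1. *)
Definition delay_solution (R : realType) (a : R) (rho : R -> R) : Prop :=
  [/\ [bounded rho t | t in `[0 : R, 1]%classic],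
      lebesgue_measurable_fun `[0 : R, 1]%classic rho,
      abs_continuous_from 1 rho &
      {ae @lebesgue_measure R, forall t : R,
         1 <= t -> is_derive t (1 : R) rho (a * rho t - rho (t - 1))}].

Definition diverges_exponentially (R : realType) (rho : R -> R) : Prop :=
  exists C lambda : R, [/\ 0 < C, 0 < lambda &
    \forall t \near +oo, C * expR (lambda * t) <= rho t].

Definition diverges_linearly (R : realType) (rho : R -> R) : Prop :=
  exists2 l : R, 0 < l & rho t / t @[t --> +oo] --> l.

Definition oscillates (R : realType) (rho : R -> R) : Prop :=
  forall T : R, exists2 t : R, T <= t & rho t = 0.

(* Main.v *)
Require Import Defs.
From mathcomp Require Import all_boot all_order all_algebra.
From mathcomp Require Import all_classical all_reals all_analysis.
From mathcomp Require Import measurable_realfun ring lra.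
Set Implicit Arguments.
Unset Strict Implicit.
Unset Printing Implicit Defensive.
Import Order.TTheory GRing.Theory Num.Theory.
Import numFieldNormedType.Exports.
Local Open Scope classical_set_scope.
Local Open Scope ring_scope.

(** The three regimes come from the characteristic equation
    lambda = a - exp(- lambda), which has a positive real root for a > 1, the
    double root 0 for a = 1 and no real root for a < 1; each case is proved
    directly, without spectral theory.

    The equation holds only almost everywhere, so every estimate rests on one
    fact about absolutely continuous functions: a bound on the almost
    everywhere derivative bounds the increments ([ac_increment_le]). The
    exceptional null set is enclosed in an open set of small measure, on which
    absolute continuity makes the total change small, while elsewhere the
    function obeys the bound locally; [local_propagation] glues the local
    estimates. It follows that the solution is differentiable everywhere past
    2, where the right-hand side is continuous ([delay_is_derive]), and from
    there on the mean value theorem suffices.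

    For 1 <= a, initial data dominated by rho 1 force rho to be nondecreasing
    ([delay_nondecreasing]): rho - rho T satisfies a differential inequality
    that keeps it nonnegative on a short interval after T. If a > 1 then
    rho' >= (a - 1) rho, hence exponential growth. If a = 1, the quantity
    J = rho t - (integral of rho over [t - 1, t]) is conserved, and is positive
    because rho increases strictly from 1 to 2. Subtracting the exact solution
    2 J t leaves a function equal to its average over the preceding unit
    interval, which is therefore bounded, and rho t / t tends to 2 J.

    If a < 1 and rho had no zeros from some point on, it could be taken
    positive there. From rho (t - 1) >= c rho t one gets
    rho (t - 1) >= exp (c - a) rho t >= (c + 1 - a) rho t, so that the ratio
    rho (t - 1) / rho t exceeds any constant eventually. Once it is large,
    rho' <= - rho (t - 1) / 2, and integrating over two half-unit intervals
    bounds the ratio by 16 ([delay_no_positive_tail]). *)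

(** * Increments of absolutely continuous functions *)

Lemma is_derive_increment (R : realType) (f : R -> R) (t d e : R) :
  0 < e -> is_derive t (1 : R) f d ->
  exists2 r : R, 0 < r &
    forall y, `|y - t| < r -> `|f y - f t - d * (y - t)| <= e * `|y - t|.
Proof.
move=> e0 [df dE].
have : h^-1 *: ((f \o shift t) (h *: (1 : R)) - f t) @[h --> 0^'] --> d.
  by rewrite -dE; exact: df.
move=> /cvgrPdist_le /(_ e e0) [r /= r0 hr].
exists r => // y yr.
have [->|yt] := eqVneq y t; first by rewrite !subrr mulr0 normr0 mulr0 subr0 normr0.
have yt0 : y - t != 0 by rewrite subr_eq0.
have := hr (y - t); rewrite /= sub0r normrN => /(_ yr yt0).
rewrite /GRing.scale/= mulr1 subrK => h.
have -> : f y - f t - d * (y - t) = - ((d - (y - t)^-1 * (f y - f t)) * (y - t)).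
  by field.
by rewrite normrN normrM ler_wpM2r.
Qed.

Lemma increment_is_derive (R : realType) (f : R -> R) (t d : R) :
  (forall e : R, 0 < e -> exists2 r : R, 0 < r &
    forall y, `|y - t| < r -> `|f y - f t - d * (y - t)| <= e * `|y - t|) ->
  is_derive t (1 : R) f d.
Proof.
move=> H.
have aux (h : R) : h != 0 -> d - h^-1 * (f (h + t) - f t) =
    - (h^-1 * (f (h + t) - f t - d * h)) by move=> h0; field.
have : h^-1 *: ((f \o shift t) (h *: (1 : R)) - f t) @[h --> 0^'] --> d.
  apply/cvgrPdist_le => e e0; have [r r0 hr] := H e e0.
  exists r => //= h; rewrite /= sub0r normrN => hr1 h0.
  rewrite /GRing.scale/= mulr1.
  have := hr (h + t); rewrite addrK => /(_ hr1) hh.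
  rewrite (aux h h0).
  by rewrite normrN normrM normfV ler_pdivrMl ?normr_gt0// [leRHS]mulrC.
by move=> c; split; [apply/cvg_ex; exists d|exact: cvg_lim].
Qed.

(** Real induction in the form of a gluing principle: each point only has to
    carry P across itself, from nearby points on its left to nearby points on
    its right. Completeness enters through the supremum of the points that
    satisfy P. *)
Lemma local_propagation (R : realType) (P : R -> Prop) (a b : R) :
  a <= b -> P a ->
  (forall t, a <= t <= b -> exists2 r, 0 < r &
     forall y z, a <= y -> y <= t -> t <= z -> z <= b ->
       t - r < y -> z < t + r -> P y -> P z) ->
  P b.
Proof.
move=> ab Pa H.
pose S := [set t | a <= t <= b /\ P t].
have Sa : S a by split=> //; rewrite lexx.
have Sb : has_ubound S by exists b => t [/andP[]].
have hS : has_sup S by split=> //; exists a.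
have sb : sup S <= b by apply: ge_sup; [exists a|move=> t [/andP[]]].
have as_ : a <= sup S by exact: ub_le_sup.
have [r r0 hr] := H (sup S) ltac:(by rewrite as_ sb).
have [y [/andP[ay yb] Py] ys] := sup_adherent r0 hS.
have ys' : y <= sup S by apply: ub_le_sup => //; split=> //; rewrite ay yb.
pose z := Num.min b (sup S + r / 2).
have sz : sup S <= z by rewrite le_min sb/= lerDl divr_ge0 ?ltW.
have zr : z < sup S + r by rewrite gt_min ltrD2l gtr_pMr ?invf_lt1 ?ltr1n ?orbT.
have zb : z <= b by rewrite ge_min lexx.
have Pz : P z by exact: (hr y z).
have : z <= sup S.
  by apply: ub_le_sup => //; split=> //; rewrite zb (le_trans as_).
rewrite ge_min => /orP[bs|]; last by lra.
suff <- : z = b by [].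
by apply/eqP; rewrite eq_le zb (le_trans bs).
Qed.

(** Absolute continuity speaks of finite families of intervals, regularity of
    the measure of open sets; this converts the second into the first. *)
Lemma sum_length_le_measure (R : realType) (U : set R) (n : nat) (u v : nat -> R) :
  open U ->
  (forall i, (i < n)%N -> u i <= v i /\ `]u i, v i[ `<=` U) ->
  (forall i j, (i < j)%N -> (j < n)%N -> v i <= u j) ->
  ((\sum_(i < n) (v i - u i))%:E <= lebesgue_measure U)%E.
Proof.
move=> oU uv ord.
pose F i := if (i < n)%N then `]u i, v i[%classic else set0.
have mF i : measurable (F i) by rewrite /F; case: ifP.
have tF : trivIset setT F.
  apply/trivIsetP => i j _ _; wlog ij : i j / (i < j)%N => [H ij|_].
    have := ij; rewrite neq_ltn => /orP[/H|/H]; first exact.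
    by rewrite setIC; apply; rewrite eq_sym.
  rewrite /F; case: ifPn => [ni|]; last by rewrite set0I.
  case: ifPn => [nj|]; last by rewrite setI0.
  rewrite -subset0 => x [] /=; rewrite !in_itv/= => /andP[_ xv] /andP[ux _].
  by have := ord _ _ ij nj; lra.
have -> : (\sum_(i < n) (v i - u i))%:E =
    lebesgue_measure (\big[setU/set0]_(i < n) F i).
  rewrite measure_bigsetU// -sumEFin; apply: eq_bigr => i _.
  rewrite /F ltn_ord/= lebesgue_measure_itv/= lte_fin.
  have [+ _] := uv i (ltn_ord i); rewrite le_eqVlt => /predU1P[->|->//].
  by rewrite ltxx subrr.
apply: le_measure; rewrite ?inE.
- by apply: bigsetU_measurable => i _; exact: mF.
- exact: open_measurable.
- rewrite -bigcup_mkord; apply: bigcup_sub => i /= ni.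
  by rewrite /F ni; have [] := uv i ni.
Qed.

(** A cover of the exceptional null set by an open set U has so small a measure
    that f changes negligibly along intervals inside U. The property glued along
    [a, b] is that f has grown by at most its allowance, plus its change along
    finitely many successive intervals inside U: a point outside U has a
    derivative at most K and uses the allowance alone, and a point of U
    contributes one more interval. *)
Lemma ac_increment_le (R : realType) (f : R -> R) (a b K : R) :
  a <= b -> abs_continuous a b f ->
  {ae @lebesgue_measure R, forall t, a <= t <= b ->
     exists2 d, is_derive t (1 : R) f d & d <= K} ->
  f b - f a <= K * (b - a).
Proof.
move=> ab acf [N [mN N0 subN]].
apply/ler_addgt0Pr => e e0.
pose c := e / 2 / (b - a + 1).
have c0 : 0 < c by rewrite !divr_gt0//; lra.
have cE : c * (b - a + 1) = e / 2 by rewrite /c mulfVK//; lra.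
(* The allowance K + c may be negative, so an interval inside U is charged an
   extra L times its length; dl also keeps the sum of these charges small. *)
pose L := `|K + c|.
have L0 : 0 <= L by exact: normr_ge0.
have [d1 d10 hd1] := acf (e / 4) ltac:(lra).
pose dl := Num.min d1 (e / 4 / (L + 1)).
have dl0 : 0 < dl by rewrite lt_min d10 !divr_gt0//; lra.
have [dld1 Ldl] : dl <= d1 /\ L * dl <= e / 4.
  have H : dl <= e / 4 / (L + 1) by rewrite ge_min lexx orbT.
  split; first by rewrite ge_min lexx.
  by move: H; rewrite ler_pdivlMr; [nra|lra].
have muN : (lebesgue_measure N < +oo)%E by move: N0 => /= ->; rewrite ltry.
have [U [oU NU muU]] := lebesgue_regularity_outer mN muN dl0.
have {}muU : (lebesgue_measure U < dl%:E)%E.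
  apply: le_lt_trans muU.
  have mU : measurable U by exact: open_measurable.
  rewrite -{1}(setDUK NU) setUC.
  apply: le_trans (measureU2 _ _ _) _ => //; first exact: measurableD.
  by move: N0 => /= ->; rewrite adde0.
pose covered t := exists n (u v : nat -> R),
  [/\ forall i, (i < n)%N -> [/\ a <= u i, u i <= v i, v i <= t & `]u i, v i[ `<=` U],
      forall i j, (i < j)%N -> (j < n)%N -> v i <= u j &
      f t - f a <= (K + c) * (t - a) + \sum_(i < n) (`|f (v i) - f (u i)| + L * (v i - u i))].
suff [n [u [v [uv ord fb]]]] : covered b.
  have sumd : \sum_(i < n) (v i - u i) < dl.
    rewrite -lte_fin; apply: le_lt_trans muU.
    by apply: sum_length_le_measure => // i ni; have [] := uv i ni.
  have small : \sum_(i < n) `|f (v i) - f (u i)| < e / 4.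
    apply: (hd1 n (u \o val) (v \o val)); last exact: lt_le_trans dld1.
      by move=> i; have [] := uv i (ltn_ord i).
    apply/trivIsetP => i j _ _; wlog ij : i j / (i < j)%N => [H ij|_].
      have := ij; rewrite neq_ltn => /orP[/H|/H]; first exact.
      by rewrite setIC; apply; rewrite eq_sym.
    rewrite -subset0 => x [] /=; rewrite !in_itv/= => /andP[_ xv] /andP[ux _].
    by have := ord _ _ ij (ltn_ord j); lra.
  move: fb; rewrite big_split/= -mulr_sumr.
  by nra.
apply: (@local_propagation _ covered a b ab).
  exists 0%N, (fun=> 0), (fun=> 0); split=> //.
  by rewrite !subrr mulr0 big_ord0 addr0.
move=> t tab; have [Ut|Ut] := pselect (U t).
  have /= [r r0 hr] := open_nbhs_nbhs (conj oU Ut).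
  exists r => // y z ay yt tz zb ry zr [n [u [v [uv ord fy]]]].
  exists n.+1, (fun i => if (i < n)%N then u i else y),
    (fun i => if (i < n)%N then v i else z); split.
  - move=> i; rewrite ltnS leq_eqVlt => /predU1P[->|ni].
      rewrite ltnn; split=> //; first exact: le_trans tz.
      move=> x /=; rewrite in_itv/= => /andP[yx xz]; apply: hr => /=.
      by rewrite /ball_/= ltr_norml; lra.
    by rewrite ni; have [? ? ? ?] := uv i ni; split=> //; lra.
  - move=> i j ij; rewrite ltnS leq_eqVlt => /predU1P[jn|jn].
      by move: ij; rewrite jn => ij; rewrite ij ltnn; have [] := uv i ij.
    by rewrite jn (ltn_trans ij jn); exact: ord.
  - rewrite big_ord_recr/= ltnn.
    under eq_bigr => i _ do rewrite ltn_ord.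
    have := ler_norm (f z - f y).
    have : - L * (z - y) <= (K + c) * (z - y).
      by rewrite ler_wpM2r ?subr_ge0 ?(le_trans yt)// lerNl /L -normrN ler_norm.
    by nra.
have [d dft dK] : exists2 d, is_derive t (1 : R) f d & d <= K.
  apply: contrapT => h; apply: Ut; apply: NU; apply: subN => /= H.
  by apply: h; exact: H.
have [r r0 hr] := is_derive_increment c0 dft.
exists r => // y z ay yt tz zb ry zr [n [u [v [uv ord fy]]]].
exists n, u, v; split=> //.
  by move=> i ni; have [? ? ? ?] := uv i ni; split=> //; lra.
have := hr y; rewrite [`|y - t|]ler0_norm ?subr_le0// => /(_ ltac:(lra)).
have := hr z; rewrite [`|z - t|]ger0_norm ?subr_ge0// => /(_ ltac:(lra)).
rewrite !ler_norml => /andP[_ hz] /andP[hy _].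
by nra.
Qed.

Lemma lebesgue_aeS (R : realType) (P Q : R -> Prop) :
  (forall t, P t -> Q t) ->
  {ae @lebesgue_measure R, forall t, P t} ->
  {ae @lebesgue_measure R, forall t, Q t}.
Proof.
move=> PQ.
by apply: (@filterS _ _ (ae_filter_ringOfSetsType (@lebesgue_measure R))).
Qed.

Lemma abs_continuousN (R : realType) (f : R -> R) (a b : R) :
  abs_continuous a b f -> abs_continuous a b (fun t => - f t).
Proof.
move=> acf e e0; have [d d0 hd] := acf e e0; exists d => // n u v uv tuv suv.
under eq_bigr => i _ do rewrite -opprD normrN.
exact: hd.
Qed.

Lemma ac_increment_ge (R : realType) (f : R -> R) (a b K : R) :
  a <= b -> abs_continuous a b f ->
  {ae @lebesgue_measure R, forall t, a <= t <= b ->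
     exists2 d, is_derive t (1 : R) f d & K <= d} ->
  K * (b - a) <= f b - f a.
Proof.
move=> ab /abs_continuousN acf aef.
suff : - f b - - f a <= - K * (b - a) by lra.
apply: (ac_increment_le (f := fun t => - f t)) => //.
apply: lebesgue_aeS aef => t H tab; have [d df Kd] := H tab.
by exists (- d); [exact: is_deriveN|rewrite lerN2].
Qed.

Lemma abs_continuous_sub (R : realType) (f : R -> R) (a b c d : R) :
  a <= c -> d <= b -> abs_continuous a b f -> abs_continuous c d f.
Proof.
move=> ac db acf e e0; have [r r0 hr] := acf e e0; exists r => // n u v uv.
by apply: hr => i; have := uv i; lra.
Qed.

(** * Regularity of solutions *)

Lemma delay_increment_le (R : realType) (a K s t : R) (rho : R -> R) :
  delay_solution a rho -> 1 <= s -> s <= t ->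
  (forall r, s <= r <= t -> a * rho r - rho (r - 1) <= K) ->
  rho t - rho s <= K * (t - s).
Proof.
move=> [_ _ ac ae] s1 st H; apply: ac_increment_le => //.
  exact: abs_continuous_sub (ac t).
apply: lebesgue_aeS ae => r hr srt; exists (a * rho r - rho (r - 1)); last exact: H.
by apply: hr; lra.
Qed.

Lemma delay_increment_ge (R : realType) (a K s t : R) (rho : R -> R) :
  delay_solution a rho -> 1 <= s -> s <= t ->
  (forall r, s <= r <= t -> K <= a * rho r - rho (r - 1)) ->
  K * (t - s) <= rho t - rho s.
Proof.
move=> [_ _ ac ae] s1 st H; apply: ac_increment_ge => //.
  exact: abs_continuous_sub (ac t).
apply: lebesgue_aeS ae => r hr srt; exists (a * rho r - rho (r - 1)); last exact: H.
by apply: hr; lra.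
Qed.

Lemma abs_continuous_unif (R : realType) (f : R -> R) (a b e : R) :
  abs_continuous a b f -> 0 < e ->
  exists2 d : R, 0 < d &
    forall s t, a <= s <= b -> a <= t <= b -> `|t - s| < d -> `|f t - f s| < e.
Proof.
move=> acf e0; have [d d0 hd] := acf e e0; exists d => // s t.
wlog st : s t / s <= t => [H sab tab std|].
  have [st|/ltW ts] := leP s t; first exact: H.
  by rewrite distrC; apply: H => //; rewrite distrC.
move=> sab tab; rewrite ger0_norm ?subr_ge0// => std.
have := hd 1%N (fun=> s) (fun=> t); rewrite !big_ord1; apply=> //.
- by move=> _; lra.
- by apply/trivIsetP => i j _ _; rewrite !ord1.
Qed.

(** Nothing is known to the left of a; freezing f there gives a function
    continuous on the whole line, to which the extreme value, intermediate value
    and integration theorems apply without restriction to a subspace. *)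
Lemma continuous_clip (R : realType) (f : R -> R) (a : R) :
  abs_continuous_from a f -> continuous (fun t => f (Num.max a t)).
Proof.
move=> acf t; apply/cvgrPdist_lt => e e0.
have [d d0 hd] := abs_continuous_unif (acf (Num.max a t + 1)) e0.
have m0 : 0 < Num.min d 1 by rewrite lt_min d0 ltr01.
exists (Num.min d 1) => //= y; rewrite /= lt_min => /andP[td t1].
have max_dist : `|Num.max a t - Num.max a y| <= `|t - y|.
  rewrite /Num.max; do 2! case: ifPn; rewrite -?leNgt => ? ?;
    rewrite ler_norml; have := ler_norm (t - y); have := ler_norm (y - t);
    rewrite (distrC y t) => *; lra.
apply: hd; last exact: le_lt_trans td.
  rewrite le_max lexx/=.
  by move: (le_lt_trans max_dist t1); rewrite ltr_norml; lra.
by rewrite le_max lexx/=; lra.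
Qed.

(** Past 2 the delayed argument lies in the range where rho is continuous, so
    near t the right-hand side is within e of its value at t, and the increment
    bounds squeeze the difference quotient. *)
Lemma delay_is_derive (R : realType) (a t : R) (rho : R -> R) :
  delay_solution a rho -> 2 < t ->
  is_derive t (1 : R) rho (a * rho t - rho (t - 1)).
Proof.
move=> sol t2; have [_ _ ac _] := sol.
have cx := continuous_clip ac; set x := (fun t => _) in cx.
have xE s : 1 <= s -> x s = rho s by move=> s1; rewrite /x max_r.
apply: increment_is_derive => e e0.
have cg : continuous (fun s => a * x s - x (s - 1)).
  move=> s; apply: cvgB; first by apply: cvgM; [exact: cvg_cst|exact: cx].
  apply: (@cvg_comp _ _ _ (fun u : R => u - 1) x (nbhs s) (nbhs (s - 1))).
    by apply: cvgB; [exact: cvg_id|exact: cvg_cst].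
  exact: cx.
have /cvgrPdist_le/(_ e e0) [r /= r0 hr] := cg t.
have m0 : 0 < Num.min r (t - 2) by rewrite lt_min r0 subr_gt0.
exists (Num.min r (t - 2)) => // y; rewrite lt_min => /andP[yr yt].
have g s : `|s - t| <= `|y - t| -> 1 <= s /\
   a * rho t - rho (t - 1) - e <= a * rho s - rho (s - 1)
     <= a * rho t - rho (t - 1) + e.
  move=> sy; have := le_lt_trans sy yt; rewrite ltr_norml => st.
  have := hr s; rewrite /= distrC => /(_ (le_lt_trans sy yr)).
  by rewrite !xE ?ler_norml; lra.
have [ty|/ltW ty] := leP t y.
- have H s : t <= s <= y -> `|s - t| <= `|y - t|.
    by move=> ?; rewrite !ger0_norm; lra.
  have := @delay_increment_le _ a (a * rho t - rho (t - 1) + e) t y rho sol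
    ltac:(lra) ty (fun s h => proj2 (andP (proj2 (g s (H s h))))).
  have := @delay_increment_ge _ a (a * rho t - rho (t - 1) - e) t y rho sol
    ltac:(lra) ty (fun s h => proj1 (andP (proj2 (g s (H s h))))).
  by rewrite ler_norml [`|y - t|]ger0_norm ?subr_ge0//; lra.
- have H s : y <= s <= t -> `|s - t| <= `|y - t|.
    by move=> ?; rewrite !ler0_norm; lra.
  have [y1 _] := g y (lexx _).
  have := @delay_increment_le _ a (a * rho t - rho (t - 1) + e) y t rho sol
    y1 ty (fun s h => proj2 (andP (proj2 (g s (H s h))))).
  have := @delay_increment_ge _ a (a * rho t - rho (t - 1) - e) y t rho sol
    y1 ty (fun s h => proj1 (andP (proj2 (g s (H s h))))).
  by rewrite ler_norml [`|y - t|]ler0_norm ?subr_le0//; lra.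
Qed.

(** * Monotone solutions and exponential growth *)

(** Method of steps with the uniform step 1 / (2 a). If rho is nondecreasing up
    to T, the delayed term on the next step is at most rho T, so
    w = rho - rho T satisfies w' >= a w with w = 0 at T. A negative minimum m of
    w would then satisfy m >= a m / (2 a) = m / 2, which is absurd; hence
    rho >= rho T and rho' >= (a - 1) rho T >= 0 throughout the step. *)
Lemma delay_nondecreasing (R : realType) (a : R) (rho : R -> R) :
  delay_solution a rho -> 1 <= a ->
  (forall t : R, 0 <= t <= 1 -> 0 <= rho t <= rho 1) ->
  forall s t : R, 1 <= s -> s <= t -> rho s <= rho t.
Proof.
move=> sol a1 rho01.
have [_ _ ac _] := sol.
have cx := continuous_clip ac; set x := (fun t => _) in cx.
have xE s : 1 <= s -> x s = rho s by move=> s1; rewrite /x max_r.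
pose h := (2 * a)^-1.
have h0 : 0 < h by rewrite invr_gt0; lra.
have ah : a * h = 2^-1 by rewrite /h invfM mulrCA mulfV ?mulr1//; lra.
have h1 : h <= 1 by nra.
have mono n s t : 1 <= s -> s <= t -> t <= 1 + n%:R * h -> rho s <= rho t.
  elim: n s t => [s t s1 st|n IHn].
    by rewrite mul0r addr0 => t1; have -> : s = t by lra.
  set T := 1 + n%:R * h in IHn.
  have T1 : 1 <= T by rewrite lerDl mulr_ge0// ltW.
  have rhoT : rho 1 <= rho T by exact: IHn.
  have rhoT0 : 0 <= rho T.
    by have := rho01 1 ltac:(lra); lra.
  have delayed r : T <= r <= T + h -> rho (r - 1) <= rho T.
    move=> Tr; have [r2|r2] := leP (r - 1) 1.
      by apply: le_trans rhoT; have := rho01 (r - 1); lra.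
    by apply: IHn; lra.
  have above r : T <= r <= T + h -> rho T <= rho r.
    move=> Tr.
    have [c cT cmin] : exists2 c, c \in `[T, T + h]%R &
        forall t, t \in `[T, T + h]%R -> x c <= x t.
      by apply: EVT_min; [lra|exact: continuous_subspaceT].
    move: cT; rewrite in_itv/= => cT.
    have minc t : T <= t <= T + h -> rho c <= rho t.
      by move=> Tt; rewrite -!xE; [apply: cmin; rewrite in_itv|lra|lra].
    apply: le_trans (minc r Tr); rewrite leNgt; apply/negP => cltT.
    have : (a * rho c - rho T) * (c - T) <= rho c - rho T.
      apply: (delay_increment_ge sol T1); first by lra.
      move=> q qc; have := minc q ltac:(lra); have := delayed q ltac:(lra).
      by nra.
    have : a * (rho c - rho T) * (c - T) <= (a * rho c - rho T) * (c - T).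
      by rewrite ler_wpM2r//; [lra|nra].
    have : (rho c - rho T) * (a * h) <= (rho c - rho T) * (a * (c - T)).
      rewrite ler_wnM2l//; first by lra.
      by rewrite ler_wpM2l//; lra.
    by rewrite ah; lra.
  have step s t : T <= s -> s <= t -> t <= T + h -> rho s <= rho t.
    move=> Ts st tT.
    suff : 0 * (t - s) <= rho t - rho s by lra.
    apply: (delay_increment_ge sol) => //; first by lra.
    move=> r rst; have := delayed r ltac:(lra); have := above r ltac:(lra).
    by nra.
  move=> s t s1 st; rewrite -addn1 natrD mulrDl mul1r addrA -/T => tT.
  have [tT'|Tt] := leP t T; first exact: IHn.
  have [sT|Ts] := leP s T; last by apply: step => //; exact: ltW.
  by apply: (@le_trans _ _ (rho T)); [exact: IHn|apply: step => //; exact: ltW].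
move=> s t s1 st.
have t0 : 0 <= (t - 1) / h by rewrite divr_ge0// ?subr_ge0 ?(le_trans s1)// ltW.
apply: (mono (Num.bound ((t - 1) / h))) => //.
by rewrite -lerBlDl -ler_pdivrMr// ltW// archi_boundP.
Qed.

Lemma MVT_is_derive (R : realType) (f df : R -> R) (s t : R) :
  s <= t -> (forall r : R, s <= r <= t -> is_derive r (1 : R) f (df r)) ->
  exists2 c, s <= c <= t & f t - f s = df c * (t - s).
Proof.
move=> st H.
have [c + ->] : exists2 c, c \in `[s, t]%R & f t - f s = df c * (t - s).
  apply: MVT_segment => //.
    by move=> r; rewrite in_itv/= => rst; apply: H; lra.
  apply: derivable_within_continuous => r; rewrite in_itv/= => rst.
  by have [] := H r rst.
by rewrite in_itv/=; exists c.
Qed.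

Lemma is_derive_mul_exp (R : realType) (f : R -> R) (t d k : R) :
  is_derive t (1 : R) f d ->
  is_derive t (1 : R) (fun s => f s * expR (k * s)) ((d + k * f t) * expR (k * t)).
Proof.
move=> df.
have de : is_derive t (1 : R) (fun s => expR (k * s)) (k * expR (k * t)).
  have : is_derive t (1 : R) (fun s => k * s) k.
    by have := is_deriveZ k (is_derive_id t (1 : R)); rewrite /GRing.scale/= mulr1.
  move=> dk; have := is_derive1_comp (is_derive_expR (k * t)) dk.
  by rewrite mulrC.
apply: (is_derive_eq (is_deriveM df de)).
by rewrite /GRing.scale/=; ring.
Qed.

(** Monotonicity gives rho' >= (a - 1) rho, so rho t * exp (- (a - 1) t) is
    nondecreasing. *)
Lemma delay_exponential (R : realType) (a : R) (rho : R -> R) :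
  1 < a ->
  (forall t : R, 2 < t -> is_derive t (1 : R) rho (a * rho t - rho (t - 1))) ->
  (forall s t : R, 1 <= s -> s <= t -> rho s <= rho t) ->
  0 < rho 1 ->
  diverges_exponentially rho.
Proof.
move=> a1 drho mono rho1.
pose y t := rho t * expR ((1 - a) * t).
have y3 t : 3 <= t -> y 3 <= y t.
  move=> t3; have [|c ct E] := @MVT_is_derive R y
      (fun s => (a * rho s - rho (s - 1) + (1 - a) * rho s) * expR ((1 - a) * s))
      3 t t3.
    by move=> r rt; apply: is_derive_mul_exp; apply: drho; lra.
  rewrite -subr_ge0 E mulr_ge0 ?subr_ge0// mulr_ge0 ?expR_ge0//.
  by have := mono (c - 1) c; lra.
exists (y 3), (a - 1); split.
- by rewrite mulr_gt0 ?expR_gt0//; have := mono 1 3; lra.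
- by lra.
- near=> t.
  have t3 : 3 <= t by near: t; exact: nbhs_pinfty_ge.
  have -> : rho t = y t * expR ((a - 1) * t).
    rewrite /y -mulrA -expRD (_ : _ + _ = 0); last by ring.
    by rewrite expR0 mulr1.
  by rewrite ler_wpM2r ?expR_ge0// y3.
Unshelve. all: by end_near. Qed.

(** * Absence of positive solutions for a < 1 *)

(** The gain 1 - a in each round of the estimate
    exp (c - a) >= 1 + c - a is positive precisely because a < 1; iterating
    it makes the ratio rho (t - 1) / rho t larger than is compatible with the
    equation. *)
Lemma delay_no_positive_tail (R : realType) (a T : R) (rho : R -> R) :
  a < 1 ->
  (forall t : R, T < t -> is_derive t (1 : R) rho (a * rho t - rho (t - 1))) ->
  ~ (forall t : R, T <= t -> 0 < rho t).
Proof.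
move=> a1 drho pos.
(* After n rounds the ratio is at least n (1 - a); the first unit of time is
   spent making rho (t - 1) positive, each round costs one more. *)
have ratio n t : T + 1 + n%:R <= t -> n%:R * (1 - a) * rho t <= rho (t - 1).
  elim: n t => [t|n IHn t].
    by rewrite addr0 !mul0r => Tt; apply/ltW/pos; lra.
  rewrite -addn1 natrD addrA => Tt.
  have n0 : 0 <= n%:R :> R by [].
  set c := n%:R * (1 - a).
  have [||q qt E] := @MVT_is_derive R (fun s => rho s * expR ((c - a) * s))
      (fun s => (a * rho s - rho (s - 1) + (c - a) * rho s) *
                expR ((c - a) * s)) (t - 1) t.
  - by lra.
  - by move=> r rt; apply: is_derive_mul_exp; apply: drho; lra.
  have dec : rho t * expR ((c - a) * t) <= rho (t - 1) * expR ((c - a) * (t - 1)).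
    rewrite -subr_le0 E mulr_le0_ge0//; last by lra.
    rewrite mulr_le0_ge0 ?expR_ge0//.
    by have := IHn q ltac:(lra); rewrite -/c; lra.
  have {}dec : rho t * expR (c - a) <= rho (t - 1).
    rewrite -(ler_pM2r (expR_gt0 ((c - a) * (t - 1)))) -mulrA -expRD.
    by rewrite (_ : c - a + _ = (c - a) * t)//; ring.
  apply: le_trans dec; rewrite mulrC ler_pM2l; last by apply: pos; lra.
  by have := expR_ge1Dx (c - a); rewrite /c; lra.
(* Beyond 16 the ratio contradicts the two half-unit drops below; the summand
   2 |a| makes the delayed term dominate a * rho t. *)
pose n := Num.bound ((17 + 2 * `|a|) / (1 - a)).
have nbig : 17 + 2 * `|a| <= n%:R * (1 - a).
  rewrite -ler_pdivrMr ?subr_gt0//; apply/ltW/archi_boundP.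
  by rewrite divr_ge0// ?subr_ge0 ?ltW// addr_ge0// mulr_ge0.
have a0 := normr_ge0 a.
have aa := ler_norm a.
pose S := T + 1 + n%:R.
have ST : T + 1 <= S by rewrite lerDl.
have speed t : S <= t -> a * rho t - rho (t - 1) <= - (rho (t - 1) / 2).
  move=> St; have p := pos t ltac:(lra); have := ratio n t St.
  have : (17 + 2 * `|a|) * rho t <= n%:R * (1 - a) * rho t by rewrite ler_pM2r.
  have : a * rho t <= `|a| * rho t by rewrite ler_pM2r.
  by lra.
have dec s t : S <= s -> s <= t -> rho t <= rho s.
  move=> Ss st; have [|c ct E] := @MVT_is_derive R rho
      (fun r => a * rho r - rho (r - 1)) s t st.
    by move=> r rst; apply: drho; lra.
  rewrite -subr_le0 E mulr_le0_ge0//; last by lra.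
  by have := speed c ltac:(lra); have := pos (c - 1) ltac:(lra); lra.
(* Over a half-unit interval rho falls by at least rho (t - 1) / 4, and it stays
   positive. *)
have half t : S + 2 <= t -> rho (t - 1) <= 4 * rho (t - 2^-1).
  move=> St; have [||c ct E] := @MVT_is_derive R rho
      (fun r => a * rho r - rho (r - 1)) (t - 2^-1) t.
  - by lra.
  - by move=> r rst; apply: drho; lra.
  have := speed c ltac:(lra); have := dec (c - 1) (t - 1) ltac:(lra) ltac:(lra).
  by have := pos t ltac:(lra); lra.
have := half (S + 3) ltac:(lra); have := half (S + 3 + 2^-1) ltac:(lra).
have -> : S + 3 + 2^-1 - 1 = S + 3 - 2^-1 by lra.
rewrite addrK.
have := ratio n (S + 3) ltac:(rewrite -/S; lra).
have := pos (S + 3) ltac:(lra).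
by nra.
Qed.

(** * Linear growth for a = 1 *)

(** Otherwise rho would be constant on [1, 2], with derivative 0, while the
    equation gives rho' t = rho 1 - rho (t - 1) > 0 for almost every t there. *)
Lemma delay_strict_growth (R : realType) (rho : R -> R) :
  delay_solution 1 rho ->
  (forall t : R, 0 <= t < 1 -> rho t < rho 1) ->
  (forall s t : R, 1 <= s -> s <= t -> rho s <= rho t) ->
  rho 1 < rho 2.
Proof.
move=> [_ _ _ ae] lt1 mono; rewrite ltNge; apply/negP => le21.
have cst t : 1 <= t <= 2 -> rho t = rho 1.
  by move=> t12; apply/le_anti; rewrite (le_trans (mono t 2 _ _))//= ?mono//; lra.
have null12 : (@lebesgue_measure R).-negligible `]1, 2[%classic.
  apply: negligibleS ae => t /=; rewrite in_itv/= => t12 H.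
  have dt := H ltac:(lra).
  have dt0 : is_derive t (1 : R) rho 0.
    apply: increment_is_derive => e e0.
    have m0 : 0 < Num.min (t - 1) (2 - t) by rewrite lt_min; lra.
    exists (Num.min (t - 1) (2 - t)) => // y.
    rewrite lt_min !ltr_norml => yt.
    rewrite !cst; [|lra|lra].
    by rewrite mul0r !subrr normr0 mulr_ge0// ltW.
  have := lt1 (t - 1) ltac:(lra).
  have : 1 * rho t - rho (t - 1) = 0.
    by have [_ <-] := dt; have [_ <-] := dt0.
  by rewrite cst; lra.
have := @measure_negligible _ _ _ (@lebesgue_measure R) _ _ null12.
move=> /(_ (measurable_itv _)).
rewrite /= lebesgue_measure_itv/= lte_fin ltr1n -EFinB => -[]; lra.
Qed.

Lemma continuous_antiderivative (R : realType) (f : R -> R) :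
  continuous f ->
  exists F : R -> R, forall t : R, 0 < t -> is_derive t (1 : R) F (f t).
Proof.
move=> cf; exists (fun t => \int[lebesgue_measure]_(s in `[0, t]) f s)%R => t t0.
have [||dF FE] := @continuous_FTC1_closed R f 0 t (t + 1) _ _ t0 (cf t).
- by rewrite ltrDl.
- apply: continuous_compact_integrable; first exact: segment_compact.
  exact: continuous_subspaceT.
- by split=> //; rewrite -derive1E.
Qed.

(** A function equal to its average over the preceding unit interval cannot
    exceed its previous maximum M: if m is its maximum over a further
    half-interval, attained at c, then m averages values at most M over at least
    half of [c - 1, c] and values at most m over the rest, so m <= M. The average
    is written with an antiderivative H. *)
Lemma moving_average_bounded (R : realType) (z H : R -> R) :
  continuous z ->
  (forall t : R, 1 <= t -> is_derive t (1 : R) H (z t)) ->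
  (forall t : R, 2 <= t -> z t = H t - H (t - 1)) ->
  exists M : R, forall t, 1 <= t -> z t <= M.
Proof.
move=> cz dH zE.
have maxz s t : s <= t ->
    exists2 c, s <= c <= t & forall r, s <= r <= t -> z r <= z c.
  move=> st; have [|c] := @EVT_max R z s t st; first exact: continuous_subspaceT.
  by rewrite in_itv/= => cst cmax; exists c.
have incr K s t : 1 <= s -> s <= t ->
    (forall r, s <= r <= t -> z r <= K) -> H t - H s <= K * (t - s).
  move=> s1 st zK.
  have [|c cst ->] := @MVT_is_derive R H z s t st.
    by move=> r rst; apply: dH; lra.
  by rewrite ler_wpM2r ?subr_ge0 ?zK.
have [c0 _ cmax] := maxz 1 2 ltac:(lra).
have bnd n t : 1 <= t -> t <= 2 + n%:R / 2 -> z t <= z c0.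
  elim: n t => [t t1|n IHn t t1].
    by rewrite mul0r addr0 => t2; apply: cmax; lra.
  set T := 2 + n%:R / 2 in IHn.
  have n0 : 0 <= n%:R :> R by [].
  rewrite -[n.+1%:R]natr1 => tT; have {}tT : t <= T + 2^-1 by rewrite /T; lra.
  have T2 : 2 <= T by rewrite /T; lra.
  have [|Tt] := leP t T; first exact: IHn.
  have [c cT maxT] := maxz T (T + 2^-1) ltac:(lra).
  apply: le_trans (maxT t ltac:(lra)) _.
  have := incr (z c) T c ltac:(lra) ltac:(lra)
    (fun r rTc => maxT r ltac:(lra)).
  have := incr (z c0) (c - 1) T ltac:(lra) ltac:(lra)
    (fun r rTc => IHn r ltac:(lra) ltac:(lra)).
  have := zE c ltac:(lra).
  move=> zcE low up; rewrite leNgt; apply/negP => lt0.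
  have : (z c - z c0) * (1 - (c - T)) <= 0 by lra.
  by rewrite leNgt mulr_gt0//; lra.
exists (z c0) => t t1; apply: (bnd (Num.bound (t * 2))) => //.
have : t * 2 < (Num.bound (t * 2))%:R by apply: archi_boundP; lra.
by lra.
Qed.

(** The conserved quantity E t is x t minus its average over [t - 1, t]. The
    linear function 2 J t solves the same equation with E = J, so the
    difference z has E = 0 and is bounded by [moving_average_bounded], applied
    to z and to - z. *)
Lemma delay_linear (R : realType) (x : R -> R) :
  continuous x ->
  (forall t : R, 2 < t -> is_derive t (1 : R) x (x t - x (t - 1))) ->
  (forall t : R, 1 <= t -> t <= 2 -> x t <= x 2) ->
  x 1 < x 2 ->
  diverges_linearly x.
Proof.
move=> cx dx mono x12.
have [G dG] := continuous_antiderivative cx.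
have dG1 (t : R) : 1 < t -> is_derive t (1 : R) (fun s => G (s - 1)) (x (t - 1)).
  move=> t1.
  have d1 : is_derive t (1 : R) (fun s => s - 1) 1.
    apply: (is_derive_eq (is_deriveB (is_derive_id t (1 : R))
      (is_derive_cst (1 : R) t (1 : R)))); by rewrite subr0.
  have dGt : is_derive (t - 1) (1 : R) G (x (t - 1)) by apply: dG; lra.
  by have := @is_derive1_comp R G (fun s => s - 1) t _ _ dGt d1; rewrite mulr1.
pose E t := x t - (G t - G (t - 1)).
have Ecst t : 2 <= t -> E t = E 2.
  move=> t2; have [||c _] := @MVT_segment R E (fun=> 0) 2 t t2.
  - move=> r; rewrite in_itv/= => r2t.
    apply: (is_derive_eq (is_deriveB (dx r _) (is_deriveB (dG r _) (dG1 r _)))).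
    + by lra.
    + by lra.
    + by lra.
    + by rewrite subrr.
  - apply: continuous_in_subspaceT => r; rewrite inE/= in_itv/= => r2t.
    apply: cvgB; first exact: cx.
    have [dGr _] := dG r ltac:(lra).
    have [dGr1 _] := dG1 r ltac:(lra).
    apply: cvgB; apply: differentiable_continuous;
      by apply/derivable1_diffP.
  - by rewrite mul0r => /subr0_eq.
pose J := E 2.
have J0 : 0 < J.
  (* Positivity of J: x is at most x 2 on [1, 2] and strictly less near 1, so
     its average over [1, 2] is less than x 2. *)
  have [r r0 hr] : exists2 r : R, 0 < r & forall s, `|s - 1| < r -> x s < x 2.
    have d0 : 0 < x 2 - x 1 by lra.
    have /cvgrPdist_lt/(_ _ d0) [r /= r0 hr] := cx 1.
    exists r => // s sr; have := hr s; rewrite /= distrC => /(_ sr).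
    by rewrite ltr_norml; lra.
  pose s := 1 + Num.min (r / 2) 2^-1.
  have s1 : 1 < s by rewrite ltrDl lt_min; lra.
  have sr : s < 1 + r by rewrite ltrD2l gt_min; apply/orP; left; lra.
  have s2 : s < 2.
    by rewrite -ltrBrDl gt_min; apply/orP; right; lra.
  have [||c cs Gs] := @MVT_is_derive R G x 1 s.
  - exact: ltW.
  - by move=> q q1; apply: dG; lra.
  have [||d ds G2] := @MVT_is_derive R G x s 2.
  - exact: ltW.
  - by move=> q q1; apply: dG; lra.
  have xc : x c < x 2 by apply: hr; rewrite ger0_norm; lra.
  have xd : x d <= x 2 by apply: mono; lra.
  have : x c * (s - 1) < x 2 * (s - 1) by rewrite ltr_pM2r; lra.
  have : x d * (2 - s) <= x 2 * (2 - s) by rewrite ler_pM2r; lra.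
  rewrite /J /E; have -> : 2 - 1 = 1 :> R by lra.
  by lra.
pose z t := x t - 2 * J * t.
pose H t := G t - J * (t * t).
have cz : continuous z.
  move=> t; apply: cvgB; first exact: cx.
  by apply: cvgM; [exact: cvg_cst|exact: cvg_id].
have dH (t : R) : 1 <= t -> is_derive t (1 : R) H (z t).
  move=> t1; have dGt : is_derive t (1 : R) G (x t) by apply: dG; lra.
  have dtt := is_deriveM (is_derive_id t (1 : R)) (is_derive_id t (1 : R)).
  apply: (is_derive_eq (is_deriveB dGt (is_deriveZ J dtt))).
  by rewrite /z /GRing.scale/=; ring.
have zE t : 2 <= t -> z t = H t - H (t - 1).
  by move=> t2; have := Ecst t t2; rewrite -/J /E /z /H; lra.
have [M zM] := moving_average_bounded cz dH zE.
have [M' zM'] : exists M, forall t, 1 <= t -> - z t <= M.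
  apply: (@moving_average_bounded R (fun t => - z t) (fun t => - H t)).
  - by move=> t; apply: cvgN; exact: cz.
  - by move=> t t1; apply: is_deriveN; exact: dH.
  - by move=> t t2; rewrite zE//; lra.
pose B := `|M| + `|M'| + 1.
have B0 : 0 < B by rewrite ltr_wpDl// addr_ge0.
have zB t : 1 <= t -> `|z t| <= B.
  move=> t1; have := zM t t1; have := zM' t t1.
  have := ler_norm M; have := ler_norm M'; rewrite ler_norml /B.
  by have := normr_ge0 M; have := normr_ge0 M'; lra.
exists (2 * J); first by lra.
apply/cvgrPdist_le => e e0; near=> t.
have t1 : 1 <= t by near: t; apply: nbhs_pinfty_ge; exact: num_real.
have tB : B / e <= t by near: t; apply: nbhs_pinfty_ge; exact: num_real.
have -> : 2 * J - x t / t = - (z t / t) by rewrite /z; field; lra.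
rewrite normrN normrM normfV (gtr0_norm (_ : 0 < t)); last by lra.
rewrite ler_pdivrMr; last by lra.
by apply: le_trans (zB t t1) _; move: tB; rewrite ler_pdivrMr// mulrC.
Unshelve. all: by end_near. Qed.

(** * The trichotomy *)

Theorem lemma3p14 (R : realType) (a : R) (rho : R -> R)
    (hrho : delay_solution a rho) :
  [/\ 1 < a ->
      (forall t : R, 0 <= t <= 1 -> 0 < rho t <= rho 1) ->
      diverges_exponentially rho,
      a = 1 ->
      (forall t : R, 0 <= t < 1 -> 0 < rho t < rho 1) ->
      diverges_linearly rho &
      a < 1 -> oscillates rho].
Proof.
have [_ _ ac _] := hrho.
have cx := continuous_clip ac; set x := (fun t => _) in cx.
have xE s : 1 <= s -> x s = rho s by move=> s1; rewrite /x max_r.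
have drho (t : R) : 2 < t -> is_derive t (1 : R) rho (a * rho t - rho (t - 1)).
  exact: delay_is_derive.
split=> [a1 init|a1 init|a1].
- apply: (delay_exponential a1 drho); last by have := init 1 ltac:(lra); lra.
  apply: (delay_nondecreasing hrho); first exact: ltW.
  by move=> t t01; have := init t t01; lra.
- subst a.
  have mono : forall s t, 1 <= s -> s <= t -> rho s <= rho t.
    apply: (delay_nondecreasing hrho) => // t t01.
    have [t1|t1] := ltP t 1; first by have := init t ltac:(lra); lra.
    by have -> : t = 1; [lra|have := init 0 ltac:(lra); lra].
  have [||||l l0 xl] := @delay_linear R x.
  + exact: cx.
  + move=> t t2; rewrite !xE; [|lra|lra].
    have near_rho : \forall s \near t, rho s = x s.
      have : 1 < t by lra.
      by move/lt_nbhsr; apply: filterS => s s1; rewrite xE// ltW.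
    apply: (near_eq_is_derive near_rho).
    by rewrite -[rho t in X in is_derive _ _ _ X]mul1r; exact: drho.
  + by move=> t t1 t2; rewrite !xE ?mono//; lra.
  + rewrite !xE//; last by lra.
    apply: (delay_strict_growth hrho) => // t t01.
    by have := init t t01; lra.
  exists l => //; apply: cvg_trans xl; apply: near_eq_cvg; near=> t.
  by rewrite xE//; near: t; apply: nbhs_pinfty_ge; exact: num_real.
- move=> T; apply: contrapT => noroot.
  pose S := Num.max T 2.
  have [TS S2] : T <= S /\ 2 <= S by rewrite !le_max !lexx orbT.
  have nz t : S <= t -> rho t != 0.
    by move=> St; apply/eqP => t0; apply: noroot; exists t => //; lra.
  have same_sign t : S <= t -> 0 < rho S * rho t.
    move=> St; rewrite ltNge; apply/negP => opp.
    have [||c] := @IVT R x S t 0 St.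
    + exact: continuous_subspaceT.
    + rewrite !xE; [|lra|lra]; rewrite ge_min le_max.
      have := nz S (lexx _); have := nz t St.
      by have [|] := leP (rho S) 0; have [|] := leP (rho t) 0; nra.
    rewrite in_itv/= => cSt; rewrite xE; last by lra.
    by move=> c0; have := nz c ltac:(lra); rewrite c0 eqxx.
  have [rhoS|rhoS] := leP (rho S) 0.
  + apply: (@delay_no_positive_tail R a S (fun t => - rho t) a1).
      move=> t St; apply: (is_derive_eq (is_deriveN (drho t _))); first by lra.
      by ring.
    by move=> t St; have := same_sign t St; nra.
  + apply: (@delay_no_positive_tail R a S rho a1).
      by move=> t St; apply: drho; lra.
    by move=> t St; have := same_sign t St; nra.
Unshelve. all: by end_near. Qed.
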